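(* Let $k,n$ be positive integers, let $0\leq r\leq k$ and $0\leq s\leq n$. If $A\subseteq\{0,\dots,k\}^{n}$ and $|A|=|L_{\leq s}(n)|$, then $|\delta_r A|\geq|\delta_r L_{\leq s}(n)|$, with equality if and only if $A=L_{\leq s}(n)$.
   Context: For $A\subseteq\{0,\dots,k\}^{n}$, the $\delta_r$-shadow $\delta_r A\subseteq\{0,\dots,k\}^{n-1}$ is the set of all sequences obtained from some vector of $A$ by removing exactly one coordinate whose value lies in $\{0,\dots,r\}$. For $x\in\{0,\dots,k\}^{n}$, $v_r(x)$ denotes the number of coordinates of $x$ with value in $\{0,\dots,r\}$. $L_s(n)=\{x\in\{0,\dots,k\}^{n} : v_r(x)=s\}$ and $L_{\leq s}(n)=\bigcup_{i=0}^{s}L_i(n)$. *)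

(* Defs.v *)
From mathcomp Require Import all_boot.

Set Implicit Arguments.
Unset Strict Implicit.
Unset Printing Implicit Defensive.

Definition del_at (T : Type) (i : nat) (x : seq T) : seq T :=
  take i x ++ drop i.+1 x.

(* The result of a deletion is compared as a sequence, so that no cast between
   tuple lengths is needed: for i : 'I_n, del_at i x has size n.-1. *)
Definition shadow (k n r : nat) (A : {set n.-tuple 'I_k.+1}) :
    {set n.-1.-tuple 'I_k.+1} :=
  [set y : n.-1.-tuple 'I_k.+1 |
    [exists x in A, exists i : 'I_n,
       (tnth x i <= r) && (tval y == del_at i x)]].

Definition v (k n r : nat) (x : n.-tuple 'I_k.+1) : nat :=
  #|[set i : 'I_n | tnth x i <= r]|.

Definition L (k n r s : nat) : {set n.-tuple 'I_k.+1} :=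
  [set x : n.-tuple 'I_k.+1 | v r x == s].

Definition Lle (k n r s : nat) : {set n.-tuple 'I_k.+1} :=
  \bigcup_(i < s.+1) L k n r i.

(* Main.v *)
(** Weight a word [y] of length [n-1] by [1 / (v y + 1)].  Every [x] with
    [v x > 0] is [v x] times [1 / v x], so a double count of the pairs
    (word of [A], position of a small letter) gives
    [#|A| <= #|L_0(n)| + n (r+1) * (weight of the shadow of A)], because a word
    of length [n-1] arises from exactly [n (r+1)] such pairs.  Equality holds for
    [A = L_{<= s}(n)].  The weight decreases strictly in [v y], so among sets of
    at most [#|L_{<= s-1}(n-1)|] words the set [L_{<= s-1}(n-1)] is the only one
    of maximal weight. *)
Require Import Defs.
From mathcomp Require Import all_boot.
From mathcomp Require Import all_order all_algebra lra.

Set Implicit Arguments.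
Unset Strict Implicit.
Unset Printing Implicit Defensive.

Import GRing.Theory Num.Theory.

Section Deletion.

Variables (T : Type) (n : nat).

(** Typed counterpart of [del_at]. Indexing by [lift i] matches the way [bigD1_ord] splits off
    position [i] of a sum. *)
Definition tdel (i : 'I_n.+1) (x : n.+1.-tuple T) : n.-tuple T :=
  [tuple tnth x (lift i j) | j < n].

(** Takes a pair so that [tins i] is a bijection, available for reindexing sums over words. *)
Definition tins (i : 'I_n.+1) (p : T * n.-tuple T) : n.+1.-tuple T :=
  [tuple oapp (tnth p.2) p.1 (unlift i j) | j < n.+1].

Lemma tval_tdel i x : tdel i x = del_at i x :> seq T.
Proof.
have ltin := ltn_ord i.
have size_take_i : size (take i x) = i by rewrite size_takel // size_tuple ltnW.
apply: (@eq_from_nth _ (tnth x i)).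
  by rewrite /del_at size_cat size_drop size_take_i !size_tuple subSS subnKC // -ltnS.
rewrite size_tuple => j ltjn; rewrite /del_at nth_cat size_take_i.
rewrite (_ : nth _ _ j = tnth (tdel i x) (Ordinal ltjn)); last first.
  by rewrite [RHS](tnth_nth (tnth x i)).
rewrite tnth_mktuple (tnth_nth (tnth x i)) /= /bump.
case: ltnP => [ltji | leij]; first by rewrite nth_take.
by rewrite nth_drop addSn subnKC.
Qed.

Lemma tnth_tins i p : tnth (tins i p) i = p.1.
Proof. by rewrite tnth_mktuple unlift_none. Qed.

Lemma tdel_tins i p : tdel i (tins i p) = p.2.
Proof. by apply: eq_from_tnth => j; rewrite !tnth_mktuple liftK. Qed.

Lemma tins_tdel i x : tins i (tnth x i, tdel i x) = x.
Proof.
apply: eq_from_tnth => j; rewrite tnth_mktuple.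
by case: unliftP => [j' | ] -> //=; rewrite tnth_mktuple.
Qed.

End Deletion.

Section Counting.

Variables (k n r : nat).

Local Notation word m := (m.-tuple 'I_k.+1).

Lemma v_tdel (i : 'I_n.+1) (x : word n.+1) :
  v r x = ((tnth x i <= r) + v r (tdel i x))%N.
Proof.
rewrite /v -!sum1_card big_mkcond (bigD1_ord i) //=.
congr (_ + _)%N; first by rewrite inE; case: (_ <= _).
by rewrite [RHS]big_mkcond; apply: eq_bigr => j _; rewrite !inE tnth_mktuple.
Qed.

Lemma mem_Lle m s (x : word m) : (x \in Lle k m r s) = (v r x <= s).
Proof.
apply/bigcupP/idP => [[i _] | lexs]; first by rewrite inE => /eqP->; rewrite -ltnS.
by exists (Ordinal (lexs : v r x < s.+1)); rewrite ?inE.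
Qed.

Lemma shadowP (A : {set word n.+1}) (y : word n) :
  reflect (exists x i, [/\ x \in A, tnth x i <= r & y = tdel i x])
          (y \in shadow r A).
Proof.
rewrite inE; apply: (iffP existsP) => [[x /andP[Ax /existsP[i]]] | [x [i [Ax xi ->]]]].
  by rewrite -tval_tdel => /andP[xi /eqP/val_inj->]; exists x, i.
by exists x; rewrite Ax; apply/existsP; exists i; rewrite xi -tval_tdel /=.
Qed.

Lemma shadow_Lle s : shadow r (Lle k n.+1 r s) = [set y | v r y < s].
Proof.
apply/setP=> y; rewrite [RHS]inE; apply/shadowP/idP => [[x [i [+ xi ->]]] | ltys].
  by rewrite mem_Lle (v_tdel i) xi.
(* The letter 0 is small whatever [r] is, so putting it in front of [y] raises [v] by exactly
   one. *)
exists (tins ord0 (ord0, y)), ord0; rewrite tnth_tins tdel_tins; split=> //.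
by rewrite mem_Lle (v_tdel ord0) tnth_tins tdel_tins.
Qed.

Local Open Scope ring_scope.

Definition weight (y : word n) : rat := (v r y).+1%:R^-1.

Lemma card_weight (A : {set word n.+1}) :
  #|A|%:R = #|[set x in A | v r x == 0%N]|%:R
    + \sum_i \sum_(x in A | (tnth x i <= r)%N) weight (tdel i x) :> rat.
Proof.
rewrite -!sum1_card !natr_sum; under [X in _ = X + _]eq_bigl do rewrite inE.
rewrite (bigID (fun x => v r x == 0%N)) /=; congr (_ + _).
under [RHS]eq_bigr do rewrite big_mkcondr.
rewrite exchange_big big_mkcondr; apply: eq_bigr => x Ax /=.
rewrite -big_mkcond /= (eq_bigr (fun=> (v r x)%:R^-1)); last first.
  by move=> i xi; rewrite /weight (v_tdel i) xi.
rewrite sumr_const -cardsE -/(v r x).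
(* For [v r x = 0] the summand is the junk value of an inverse of 0, but it is taken zero times. *)
have [-> | v_neq0] := eqVneq; first by rewrite mulr0n.
by rewrite -[RHS]mulr_natl mulfV ?pnatr_eq0.
Qed.

Hypothesis le_rk : (r <= k)%N.

Lemma card_small : #|[pred a : 'I_k.+1 | (a <= r)%N]| = r.+1.
Proof.
have widen_inj : injective (widen_ord (le_rk : (r < k.+1)%N)).
  by move=> a b /(congr1 val) eq_ab; apply: val_inj.
rewrite -[RHS]card_ord -(card_image widen_inj).
apply: eq_card => a; rewrite inE; apply/idP/imageP => [lear | [b _ ->]]; last first.
  by rewrite -ltnS /=.
by exists (Ordinal (lear : (a < r.+1)%N)) => //; apply: val_inj.
Qed.

(** For a fixed position, a word is the same as its letter there together with the rest, so each [y]
    comes from one word per small letter. *)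
Lemma sum_tdel (B : {set word n}) (i : 'I_n.+1) :
  \sum_(x : word n.+1 | (tnth x i <= r)%N && (tdel i x \in B)) weight (tdel i x)
  = r.+1%:R * \sum_(y in B) weight y.
Proof.
rewrite (reindex (tins i)); last first.
  by exists (fun x => (tnth x i, tdel i x)) => [[a y] | x] _;
     rewrite ?tins_tdel ?tnth_tins ?tdel_tins.
under eq_bigl do rewrite tnth_tins tdel_tins.
under eq_bigr do rewrite tdel_tins.
rewrite -(pair_big (fun a : 'I_k.+1 => (a <= r)%N) (mem B) (fun _ y => weight y)) /=.
by rewrite sumr_const card_small mulr_natl.
Qed.

Lemma card_le_weight (A : {set word n.+1}) :
  #|A|%:R <= #|[set x : word n.+1 | v r x == 0%N]|%:R
    + n.+1%:R * (r.+1%:R * \sum_(y in shadow r A) weight y).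
Proof.
rewrite card_weight lerD //.
  by rewrite ler_nat subset_leq_card //; apply/subsetP=> x; rewrite !inE => /andP[].
rewrite mulr_natl -[X in _ *+ X]card_ord -sumr_const; apply: ler_sum => i _.
rewrite -(sum_tdel _ i) [leRHS]big_mkcond [leLHS]big_mkcond; apply: ler_sum => x _ /=.
case: ifP => [/andP[Ax xi] | _]; last by case: ifP => // _; rewrite invr_ge0.
by rewrite xi (_ : tdel i x \in _) //; apply/shadowP; exists x, i.
Qed.

(** No loss occurs here: when position [i] of [x] is small, [x] lies in [Lle] exactly if [tdel i x]
    has [v] below [s], so whole fibres of the deletion are counted. *)
Lemma card_Lle_weight s :
  #|Lle k n.+1 r s|%:R = #|[set x : word n.+1 | v r x == 0%N]|%:R
    + n.+1%:R * (r.+1%:R * \sum_(y in [set y | (v r y < s)%N]) weight y).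
Proof.
rewrite card_weight; congr (_%:R + _).
  by apply: eq_card => x; rewrite !inE mem_Lle; case: eqP => [-> | _]; rewrite ?andbF.
rewrite mulr_natl -[X in _ *+ X]card_ord -sumr_const; apply: eq_bigr => i _.
rewrite -(sum_tdel _ i); apply: eq_bigl => x; rewrite mem_Lle inE (v_tdel i).
by case: (tnth x i <= r)%N; rewrite ?andbF ?andbT.
Qed.

End Counting.

Local Open Scope ring_scope.

Section Threshold.

Variables (R : realFieldType) (T : finType) (g : T -> R) (c : R) (B0 B : {set T}).
Hypotheses (c_gt0 : 0 < c) (g_in : {in B0, forall y, c <= g y}).
Hypothesis g_out : forall y, y \notin B0 -> g y < c.
Hypothesis le_sum : \sum_(y in B0) g y <= \sum_(y in B) g y.

(** Both factors have the same sign: [c] separates the values of [g] on [B0] from those outside. *)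
Let excess_term y : 0 <= (g y - c) * ((y \in B0)%:R - (y \in B)%:R).
Proof.
have [yB0 | yB0] := boolP (y \in B0); [have := g_in yB0 | have := g_out yB0];
  by case: (y \in B) => /=; lra.
Qed.

Let excess_sum : \sum_y (g y - c) * ((y \in B0)%:R - (y \in B)%:R)
  = \sum_(y in B0) g y - \sum_(y in B) g y - c * (#|B0|%:R - #|B|%:R).
Proof.
have sum_in (C : {set T}) :
    \sum_y (g y - c) * (y \in C)%:R = \sum_(y in C) g y - c * #|C|%:R.
  rewrite mulr_natr -sumr_const -sumrB [RHS]big_mkcond; apply: eq_bigr => y _.
  by case: (y \in C); rewrite ?mulr1 ?mulr0.
under eq_bigr do rewrite mulrBr.
rewrite sumrB !sum_in; lra.
Qed.

(** Nonnegativity of the total excess bounds [c * (#|B0| - #|B|)] by a difference of sums that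
    [le_sum] makes at most 0. *)
Lemma threshold_card_le : (#|B0| <= #|B|)%N.
Proof.
have : 0 <= \sum_y (g y - c) * ((y \in B0)%:R - (y \in B)%:R).
  by apply: sumr_ge0 => y _.
rewrite excess_sum -(ler_nat R) -subr_le0 -(pmulr_rle0 _ c_gt0).
have := le_sum; lra.
Qed.

Lemma threshold_card_eq : #|B| = #|B0| -> B = B0.
Proof.
move=> eqBB0; apply/eqP; rewrite eqEcard eqBB0 leqnn andbT.
apply/subsetP => y yB; apply/negPn/negP => yB0.
(* With equal cardinalities the total excess is at most 0, yet a [y] in [B] outside [B0] would
   contribute [c - g y > 0]. *)
have : (g y - c) * ((y \in B0)%:R - (y \in B)%:R)
       <= \sum_y (g y - c) * ((y \in B0)%:R - (y \in B)%:R).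
  by rewrite (bigD1 y) //= lerDl; apply: sumr_ge0.
rewrite excess_sum eqBB0 yB (negPf yB0) /=.
have := g_out yB0; have := le_sum; lra.
Qed.

End Threshold.

Local Close Scope ring_scope.

Theorem corollary11 (k n r s : nat) (hk : 0 < k) (hn : 0 < n)
  (hr : r <= k) (hs : s <= n) (A : {set n.-tuple 'I_k.+1})
  (hA : #|A| = #|Lle k n r s|) :
  #|shadow r (Lle k n r s)| <= #|shadow r A| /\
  (#|shadow r A| = #|shadow r (Lle k n r s)| <-> A = Lle k n r s).
Proof.
case: n hn hs A hA => // n _ _ A hA /=.
rewrite shadow_Lle; set B0 := [set y | _].
have le_weight : (\sum_(y in B0) weight r y <= \sum_(y in shadow r A) weight r y)%R.
  have := card_le_weight hr A; rewrite hA card_Lle_weight //.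
  by rewrite lerD2l !ler_pM2l ?ltr0n.
(* [v r y + 1] is at most [s] on [B0] and at least [s + 1] off it. The midpoint [s + 1/2] separates
   the two and stays positive for [s = 0]. *)
pose c : rat := (s%:R + 2^-1)^-1%R.
have s_ge0 : (0 <= s%:R :> rat)%R by [].
have c_gt0 : (0 < c)%R by rewrite invr_gt0; lra.
have weight_in : {in B0, forall y, (c <= weight r y)%R}.
  move=> y; rewrite inE -(ler_nat rat) => ltys.
  by rewrite lef_pV2 ?posrE ?ltr0n //; lra.
have weight_out y : y \notin B0 -> (weight r y < c)%R.
  rewrite inE -leqNgt -(ler_nat rat) => leys.
  by rewrite ltf_pV2 ?posrE ?ltr0n // -?[(v r y).+1%:R%R]natr1; lra.
split; first exact: threshold_card_le c_gt0 weight_in weight_out le_weight.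
split=> [eq_card | ->]; last by rewrite shadow_Lle.
have shA := threshold_card_eq weight_in weight_out le_weight eq_card.
(* By cardinality an inclusion suffices. A word with [v] above [s] has a small letter, and deleting
   it leaves a shadow word with [v] at least [s], outside [B0]. *)
apply/eqP; rewrite eqEcard hA leqnn andbT; apply/subsetP => x Ax.
rewrite mem_Lle leqNgt; apply/negP => ltsx.
have /card_gt0P[i] : 0 < v r x by apply: leq_ltn_trans ltsx.
rewrite inE => xi.
have : tdel i x \in shadow r A by apply/shadowP; exists x, i.
by rewrite shA inE ltnNge; move: ltsx; rewrite (v_tdel r i) xi ltnS => ->.
Qed.
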